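(* Let $\mathfrak{N}$ be a nest of subspaces of a vector space $\mathfrak{X}$ over a field $\mathbb{F}$ such that $\mathfrak{N}\setminus\{\mathfrak{X}\}$, ordered by inclusion, has order type $\omega$, the first infinite ordinal. Then $\mathfrak{N}^{\bot}=\{M^{\bot}:M\in\mathfrak{N}\}$ is a nest of subspaces of $\mathfrak{X}'$, $\mathfrak{N}^{\bot}\setminus\{\{0\}\}$ ordered by inclusion is anti-isomorphic to $\omega$, and $$(\operatorname{Alg}\mathfrak{N}^{\bot})_{-}=\operatorname{Rad}(\operatorname{Alg}\mathfrak{N}^{\bot}).$$
   Context: For a vector space $\mathfrak{Y}$ over $\mathbb{F}$, $\mathcal{L}(\mathfrak{Y})$ is the algebra of all linear operators $\mathfrak{Y}\to\mathfrak{Y}$. A nest $\mathfrak{M}$ in $\mathfrak{Y}$ is a set of subspaces of $\mathfrak{Y}$, totally ordered by inclusion, containing $\{0\}$ and $\mathfrak{Y}$, and complete, i.e. closed under arbitrary intersections and arbitrary unions of its members (the empty union being $\{0\}$ and the empty intersection being $\mathfrak{Y}$). $\operatorname{Alg}\mathfrak{M}$ is the algebra of all $T\in\mathcal{L}(\mathfrak{Y})$ with $T(M)\subseteq M$ for every $M\in\mathfrak{M}$. For $y\in\mathfrak{Y}$, $\mathfrak{M}(y)_{-}=\bigcup\{M\in\mathfrak{M}:y\notin M\}$ (so $\mathfrak{M}(0)_{-}=\{0\}$). The strictly triangular ideal of $\operatorname{Alg}\mathfrak{M}$ is $(\operatorname{Alg}\mathfrak{M})_{-}=\{T\in\operatorname{Alg}\mathfrak{M}:Ty\in\mathfrak{M}(y)_{-}\text{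 for all }y\in\mathfrak{Y}\}$. $\operatorname{Rad}$ denotes the Jacobson radical of a ring with identity, i.e. the intersection of all its maximal left ideals. $\mathfrak{X}'$ is the algebraic dual of $\mathfrak{X}$ (all linear maps $\mathfrak{X}\to\mathbb{F}$), and for $M\subseteq\mathfrak{X}$, $M^{\bot}=\{\varphi\in\mathfrak{X}':M\subseteq\ker\varphi\}$. *)

(* Defs.v *)
From HB Require Import structures.
From mathcomp Require Import all_boot all_algebra.
From mathcomp Require Import boolp classical_sets functions.

Set Implicit Arguments.
Unset Strict Implicit.
Unset Printing Implicit Defensive.

Import GRing.Theory.
Local Open Scope ring_scope.
Local Open Scope classical_set_scope.

(* [{linear U -> V}] as an [R]-module under pointwise operations, and
   [{linear U -> U}] as a ring under composition.  In particular the algebraic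
   dual of an [F]-vector space [X] is the [F]-vector space [{linear X -> F^o}]. *)
Section LinearMaps.
Context {R : comPzRingType}.
Implicit Types U V : lmodType R.

HB.instance Definition _ U V := gen_eqMixin {linear U -> V}.
HB.instance Definition _ U V := gen_choiceMixin {linear U -> V}.

Lemma linear_ext U V (f g : {linear U -> V}) : f =1 g -> f = g.
Proof.
case: f g => f [[f1] [f2]] [g [[g1] [g2]]] /= /funext fg.
case: _ / fg g1 g2 => g1 g2.
by rewrite (Prop_irrelevance f1 g1) (Prop_irrelevance f2 g2).
Qed.

Section Module.
Variables U V : lmodType R.
Implicit Types (f g : {linear U -> V}) (a : R).

Definition lin_zero : {linear U -> V} := \0.
Definition lin_opp f : {linear U -> V} := \- f.
Definition lin_add f g : {linear U -> V} := f \+ g.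
Definition lin_scale a f : {linear U -> V} := a \*: f.

Let lin_addA : associative lin_add.
Proof. by move=> f g h; apply: linear_ext => x /=; rewrite addrA. Qed.
Let lin_addC : commutative lin_add.
Proof. by move=> f g; apply: linear_ext => x /=; rewrite addrC. Qed.
Let lin_add0 : left_id lin_zero lin_add.
Proof. by move=> f; apply: linear_ext => x /=; rewrite add0r. Qed.
Let lin_addN : left_inverse lin_zero lin_opp lin_add.
Proof. by move=> f; apply: linear_ext => x /=; rewrite addNr. Qed.

HB.instance Definition _ := GRing.isZmodule.Build {linear U -> V}
  lin_addA lin_addC lin_add0 lin_addN.

Let lin_scaleA a b f : lin_scale a (lin_scale b f) = lin_scale (a * b) f.
Proof. by apply: linear_ext => x /=; rewrite scalerA. Qed.
Let lin_scale1 : left_id 1 lin_scale.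
Proof. by move=> f; apply: linear_ext => x /=; rewrite scale1r. Qed.
Let lin_scaleDr : right_distributive lin_scale +%R.
Proof. by move=> a f g; apply: linear_ext => x /=; rewrite scalerDr. Qed.
Let lin_scaleDl f : {morph lin_scale^~ f : a b / a + b}.
Proof. by move=> a b; apply: linear_ext => x /=; rewrite scalerDl. Qed.

HB.instance Definition _ := GRing.Zmodule_isLmodule.Build R {linear U -> V}
  lin_scaleA lin_scale1 lin_scaleDr lin_scaleDl.

Lemma lin_zeroE x : (0 : {linear U -> V}) x = 0. Proof. by []. Qed.
Lemma lin_oppE f x : (- f) x = - f x. Proof. by []. Qed.
Lemma lin_addE f g x : (f + g) x = f x + g x. Proof. by []. Qed.
Lemma lin_scaleE a f x : (a *: f) x = a *: f x. Proof. by []. Qed.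
End Module.

Section Ring.
Variable U : lmodType R.
Implicit Types f g : {linear U -> U}.

Definition lin_one : {linear U -> U} := idfun.
Definition lin_mul f g : {linear U -> U} := f \o g.

Let lin_mulA : associative lin_mul.
Proof. by move=> f g h; apply: linear_ext. Qed.
Let lin_mul1l : left_id lin_one lin_mul.
Proof. by move=> f; apply: linear_ext. Qed.
Let lin_mul1r : right_id lin_one lin_mul.
Proof. by move=> f; apply: linear_ext. Qed.
Let lin_mulDl : left_distributive lin_mul +%R.
Proof. by move=> f g h; apply: linear_ext. Qed.
Let lin_mulDr : right_distributive lin_mul +%R.
Proof. by move=> f g h; apply: linear_ext => x /=; rewrite linearD. Qed.

HB.instance Definition _ := GRing.Zmodule_isPzRing.Build {linear U -> U}
  lin_mulA lin_mul1l lin_mul1r lin_mulDl lin_mulDr.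

Lemma lin_oneE x : (1 : {linear U -> U}) x = x. Proof. by []. Qed.
Lemma lin_mulE f g x : (f * g) x = f (g x). Proof. by []. Qed.
End Ring.
End LinearMaps.

Section Radical.
Context {R : pzRingType}.

(* Below, [A] is meant to be (the carrier of) a unital subring of [R]; ideals
   and the radical are those of the ring [A], not of [R]. *)
Definition left_ideal (A I : set R) : Prop :=
  [/\ I `<=` A, zmod_closed [in I] & forall a x, A a -> I x -> I (a * x)].

Definition maximal_left_ideal (A I : set R) : Prop :=
  [/\ left_ideal A I, I <> A &
      forall J, left_ideal A J -> I `<=` J -> J = I \/ J = A].

Definition jacobson_radical (A : set R) : set R :=
  A `&` \bigcap_(I in maximal_left_ideal A) I.
End Radical.

Section Nests.
Context {F : fieldType} {Y : lmodType F}.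
Implicit Type M : set (set Y).

(* Union of a family of subspaces, with the convention that the empty union
   is [{0}]. *)
Definition subspace_bigcup (C : set (set Y)) : set Y :=
  [set 0] `|` \bigcup_(L in C) L.

Definition is_nest M : Prop :=
  [/\ forall L, M L -> submod_closed [in L],
      forall L1 L2, M L1 -> M L2 -> L1 `<=` L2 \/ L2 `<=` L1,
      M [set 0] /\ M setT,
      forall C, C `<=` M -> M (\bigcap_(L in C) L) &
      forall C, C `<=` M -> M (subspace_bigcup C)].

Definition Alg M : set {linear Y -> Y} :=
  [set T : {linear Y -> Y} | forall L, M L -> T @` L `<=` L].

Definition nest_pred M (y : Y) : set Y :=
  subspace_bigcup [set L | M L /\ ~ L y].

Definition strictly_triangular_ideal M : set {linear Y -> Y} :=
  [set T : {linear Y -> Y} | Alg M T /\ forall y, nest_pred M y (T y)].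

Lemma Alg_subring M : is_nest M -> subring_closed [in Alg M].
Proof.
case=> sub _ _ _ _.
have memA (T : {linear Y -> Y}) :
    T \in Alg M -> forall L y, M L -> L y -> L (T y).
  by move=> /set_mem AT L y ML Ly; apply: (AT L ML); exists y.
split=> [|S T /memA AS /memA AT|S T /memA AS /memA AT].
- by apply/mem_set => L ML _ [y Ly <-].
- apply/mem_set => L ML _ [y Ly <-]; have [L0 linL] := sub L ML.
  have := linL (-1) (T y) (S y) (mem_set (AT L y ML Ly)).
  by move=> /(_ (mem_set (AS L y ML Ly))) /set_mem; rewrite scaleN1r addrC.
- apply/mem_set => L ML _ [y Ly <-]; apply: (AS) => //; exact: AT.
Qed.
End Nests.

Section OrderType.
Context {T : Type}.
Implicit Type S : set (set T).

Definition order_type_omega S : Prop :=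
  exists2 f : nat -> set T, set_bij setT S f &
    forall m n, (m <= n)%N <-> f m `<=` f n.

Definition anti_isomorphic_omega S : Prop :=
  exists2 f : nat -> set T, set_bij setT S f &
    forall m n, (m <= n)%N <-> f n `<=` f m.
End OrderType.

Section Dual.
Context {F : fieldType} {X : lmodType F}.

Definition annihilator (L : set X) : set {linear X -> F^o} :=
  [set phi : {linear X -> F^o} | forall x, L x -> phi x = 0].

Definition annihilator_nest (N : set (set X)) : set (set {linear X -> F^o}) :=
  annihilator @` N.
End Dual.

(* Main.v *)
Require Import Defs.
From HB Require Import structures.
From mathcomp Require Import all_boot all_algebra.
From mathcomp Require Import boolp classical_sets functions.

(** Write [f 0 < f 1 < ...] for the proper members of [N] and [M n] for the
    annihilator of [f n].

    Separating points from subspaces by functionals ([separating_functional])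
    makes [K |-> annihilator K] strictly decreasing on subspaces, so the [M n],
    together with [0], form a strictly decreasing sequence.  Annihilators turn
    unions into intersections, and a union of some of the [M n] is the one of
    least index; hence they form a nest, anti-isomorphic to omega.

    For any nest, the radical of its algebra consists of strictly triangular
    operators ([jacobson_sub_triangular]).  Indeed the rank-one operators of
    the algebra move a nonzero [y] onto every vector lying in all the members
    that contain [y], which makes the operators [T] with
    [T y \in nest_pred M y] a maximal left ideal.

    Conversely, the strictly triangular operators form a left ideal, so it
    suffices to invert [1 - T] from the left for each of them
    ([quasiregular_sub_jacobson]).  Such a [T] sends [M n] into [M n.+1], hence
    [T ^+ k phi] vanishes on [f k].  As the [f k] exhaust [X], for each [x]
    only finitely many terms of [\sum_k (T ^+ k phi) x] are nonzero: the
    Neumann series converges pointwise on [X], and its sum is the left inverse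
    ([triangular_quasi_invertible]). *)

Import GRing.Theory.
Local Open Scope ring_scope.
Local Open Scope classical_set_scope.

(** * Functionals separating points from subspaces *)

Section Functionals.
Context {F : fieldType}.
Implicit Type X : lmodType F.

Lemma submod_setP {X} (L : set X) : submod_closed [in L] <->
  L 0 /\ forall a u v, L u -> L v -> L (a *: u + v).
Proof.
split=> [[/set_mem L0 lin]|[L0 lin]].
  by split=> // a u v Lu Lv; apply: set_mem; apply: lin; apply: mem_set.
by split=> [|a u v /set_mem Lu /set_mem Lv]; apply: mem_set => //; apply: lin.
Qed.

Lemma maximal_avoiding_submod {X} (W : set X) (x : X) :
    submod_closed [in W] -> ~ W x ->
  exists H : set X, [/\ submod_closed [in H], W `<=` H, ~ H x &
    forall K, submod_closed [in K] -> H `<=` K -> ~ K x -> K `<=` H].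
Proof.
move=> /submod_setP[W0 linW] Wx.
(* Adding [W] to every set lets the empty chain have an admissible union. *)
pose P (A : set X) := submod_closed [in A `|` W] /\ ~ (A `|` W) x.
have [A [[subA Ax] maxA]] : exists A, P A /\ forall B, A `<` B -> ~ P B.
  apply: Zorn_bigcup => C CP totC; split; last first.
    by case=> // -[A CA Ax]; case: (CP A CA) => _; apply; left.
  apply/submod_setP; split=> [|a u v]; first by right.
  have step A : C A -> (A `|` W) u -> (A `|` W) v ->
      (\bigcup_(A in C) A `|` W) (a *: u + v).
    move=> CA Au Av; have [/submod_setP[_ lin] _] := CP A CA.
    by case: (lin a u v Au Av) => ?; [left; exists A|right].
  case=> [[A CA Au]|Wu] [[B CB Bv]|Wv].
  - case: (totC A B CA CB) => AB.
      by apply: (step B CB); [left; apply: AB|left].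
    by apply: (step A CA); [left|left; apply: AB].
  - by apply: (step A CA); [left|right].
  - by apply: (step B CB); [right|left].
  - by right; apply: linW.
exists (A `|` W); split=> // K subK AK Kx.
apply: contrapT => KA; apply: (maxA K).
  by split=> [|KleA]; [move=> z Az; apply: AK; left|apply: KA => z /KleA; left].
have -> : P K = (submod_closed [in K] /\ ~ K x) => //.
by rewrite /P (_ : K `|` W = K) //; apply: setUidl => z Wz; apply: AK; right.
Qed.

(** A subspace [H] maximal among those containing [W] but not [x] has the line
    of [x] as a complement; [phi] is the coordinate along that line. *)
Lemma separating_functional {X} (W : set X) (x : X) :
    submod_closed [in W] -> ~ W x ->
  exists2 phi : {linear X -> F^o}, annihilator W phi & phi x = 1.
Proof.
move=> subW Wx; have [H [/submod_setP[H0 linH] WH Hx maxH]] :=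
  maximal_avoiding_submod W x subW Wx.
have coord v : exists c : F, H (v - c *: x).
  have [Hv|Hv] := pselect (H v); first by exists 0; rewrite scale0r subr0.
  (* By maximality [x] lies in the span of [H] and [v]; solve for [v]. *)
  pose K : set X := [set u | exists c, H (u - c *: v)].
  have [c Hc] : K x.
    apply: contrapT => Kx; apply: Hv; apply: (maxH K) => //; last first.
    - by exists 1; rewrite scale1r subrr.
    - by move=> u Hu; exists 0; rewrite scale0r subr0.
    apply/submod_setP; split; first by exists 0; rewrite scale0r subr0.
    move=> a u w [c Hc] [d Hd]; exists (a * c + d).
    have := linH a _ _ Hc Hd.
    by rewrite scalerBr scalerA addrACA -opprD scalerDl.
  have c0 : c != 0.
    by apply: contra_notN Hx => /eqP c0; rewrite c0 scale0r subr0 in Hc.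
  exists c^-1; have := linH (- c^-1) _ _ Hc H0.
  by rewrite addr0 scalerBr scalerA mulNr mulVf // scaleN1r opprK scaleNr addrC.
have [p Hp] := choice coord.
have pE v c : H (v - c *: x) -> p v = c.
  move=> Hc; apply: contrapT => /eqP; rewrite -subr_eq0 => pc0; apply: Hx.
  have := linH (-1) _ _ (Hp v) Hc.
  rewrite scaleN1r opprB addrA subrK -scalerBl => Hxx.
  have := linH (p v - c)^-1 _ _ Hxx H0.
  by rewrite addr0 scalerA mulVf // scale1r.
have linp : linear (p : X -> F^o).
  move=> a u v; apply: pE.
  have := linH a _ _ (Hp u) (Hp v).
  by rewrite scalerBr scalerA addrACA -opprD -scalerDl.
pose phi : {linear X -> F^o} :=
  HB.pack (p : X -> F^o) (GRing.isLinear.Build F X F^o _ _ linp).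
exists phi => [w Ww|]; last by apply: pE; rewrite scale1r subrr.
by apply: pE; rewrite scale0r subr0; apply: WH.
Qed.
End Functionals.

(** * Quasi-regular left ideals *)

Section Quasiregular.
Context {R : pzRingType}.
Implicit Types A I J : set R.

Lemma zmod_setP I : zmod_closed [in I] <->
  I 0 /\ forall u v, I u -> I v -> I (u - v).
Proof.
split=> [[/set_mem I0 IB]|[I0 IB]].
  by split=> // u v Iu Iv; apply: set_mem; apply: IB; apply: mem_set.
by split=> [|u v /set_mem Iu /set_mem Iv]; apply: mem_set => //; apply: IB.
Qed.

Lemma left_ideal_one A I : left_ideal A I -> I 1 -> I = A.
Proof.
case=> IA _ AI I1; apply/seteqP; split=> // a Aa.
by rewrite -(mulr1 a); apply: AI.
Qed.

(** If a maximal left ideal [I] missed [t] in [J], then [I + A t = A] would put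
    some [1 - a * t] in [I]; being left invertible, it would make [I]
    improper. *)
Lemma quasiregular_sub_jacobson A J : subring_closed [in A] -> left_ideal A J ->
    (forall x, J x -> exists2 b, A b & b * (1 - x) = 1) ->
  J `<=` jacobson_radical A.
Proof.
move=> [/set_mem A1 AB AM] [JA _ AJ] qr t Jt; split; first exact: JA.
move=> I [lI IneqA maxI]; have [IA /zmod_setP[I0 IB] AI] := lI.
apply: contrapT => It.
pose K := [set x | exists2 a, A a & I (x - a * t)].
have A0 : A 0 by apply: IA.
have AB' a b : A a -> A b -> A (a - b).
  by move=> Aa Ab; apply: set_mem; apply: AB; apply: mem_set.
have AM' a b : A a -> A b -> A (a * b).
  by move=> Aa Ab; apply: set_mem; apply: AM; apply: mem_set.
have At : A t by apply: JA.
have lK : left_ideal A K.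
  split.
  - move=> x [a Aa /IA Ax].
    rewrite -(subrK (a * t) x) -[X in _ + X]opprK -[X in _ - X]sub0r.
    by apply: (AB') => //; apply: (AB') => //; apply: (AM').
  - apply/zmod_setP; split; first by exists 0; rewrite ?mul0r ?subr0.
    move=> u v [a Aa Iu] [b Ab Iv]; exists (a - b); first exact: (AB').
    have := IB _ _ Iu Iv.
    by rewrite opprB [b * t - _]addrC addrACA [- _ + b * t]addrC mulrBl opprB.
  - move=> a x Aa [b Ab Ix]; exists (a * b); first exact: (AM').
    by rewrite -mulrA -mulrBr; apply: AI.
have IK : I `<=` K by move=> x Ix; exists 0; rewrite ?mul0r ?subr0.
case: (maxI K lK IK) => KE.
  apply: It; rewrite -KE; exists 1 => //.
  by rewrite mul1r subrr.
have [a Aa I1] : K 1 by rewrite KE.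
have [b Ab b1] := qr _ (AJ a t Aa Jt).
by apply: IneqA; apply: left_ideal_one => //; rewrite -b1; apply: AI.
Qed.
End Quasiregular.

(** * The radical of an arbitrary nest algebra *)

Section NestAlgebras.
Context {F : fieldType} {Y : lmodType F}.
Implicit Types (M : set (set Y)) (L : set Y) (S T : {linear Y -> Y}).

Lemma nest_submod M L : is_nest M -> M L ->
  L 0 /\ forall a u v, L u -> L v -> L (a *: u + v).
Proof. by case=> sub _ _ _ _ ML; apply/submod_setP; apply: sub. Qed.

Lemma Alg_stable M T L y : Alg M T -> M L -> L y -> L (T y).
Proof. by move=> AT ML Ly; apply: (AT L ML); exists y. Qed.

Lemma nest_pred_mem M y : is_nest M -> M (nest_pred M y).
Proof. by case=> _ _ _ _; apply => L []. Qed.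

Lemma not_nest_pred M y : y <> 0 -> ~ nest_pred M y y.
Proof. by move=> y0 [//|[L [_ Ly] /Ly]]. Qed.

(** The operator is [u |-> phi u *: z], where [phi] separates [y] from
    [nest_pred M y]: a member without [y] is killed by [phi], and a member with
    [y] contains the range. *)
Lemma Alg_transitive M (y z : Y) : is_nest M -> y <> 0 ->
    (forall L, M L -> L y -> L z) -> exists2 T, Alg M T & T y = z.
Proof.
move=> nM y0 yz.
have [phi phi0 phi1] : exists2 phi : {linear Y -> F^o},
    annihilator (nest_pred M y) phi & phi y = 1.
  apply: separating_functional; last exact: not_nest_pred.
  by case: (nM) => sub _ _ _ _; apply: sub; apply: nest_pred_mem.
have lin : linear (fun u => phi u *: z).
  by move=> a u v; rewrite linearP scalerDl -scalerA.
pose T : {linear Y -> Y} :=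
  HB.pack (fun u => phi u *: z) (GRing.isLinear.Build F Y Y _ _ lin).
exists T; last by rewrite /= phi1 scale1r.
move=> L ML _ [u Lu <-] /=; have [L0 linL] := nest_submod M L nM ML.
have [Ly|Ly] := pselect (L y).
  by have := linL (phi u) z 0 (yz L ML Ly) L0; rewrite addr0.
by rewrite phi0 ?scale0r //; right; exists L.
Qed.

(** If [B] is outside this ideal, every member that contains [B y] contains [y],
    so some [S] in the algebra takes [B y] back to [y]; then [1 - S * B] kills
    [y], and [1] is in any left ideal containing [B] and this one. *)
Lemma maximal_left_ideal_nest_pred M y : is_nest M -> y <> 0 ->
  maximal_left_ideal (Alg M) [set T | Alg M T /\ nest_pred M y (T y)].
Proof.
move=> nM y0; set I := [set T | _].
have MP := nest_pred_mem M y nM; have [P0 linP] := nest_submod M _ nM MP.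
have [/set_mem A1 AB AM] := Alg_subring nM.
have lI : left_ideal (Alg M) I.
  split; first by move=> T [].
    apply/zmod_setP; split.
      by split=> // L ML _ [u _ <-] /=; case: (nest_submod M L nM ML).
    move=> S T [AS PS] [AT PT]; split.
      by apply: set_mem; apply: AB; apply: mem_set.
    by have := linP (-1) _ _ PT PS; rewrite scaleN1r addrC.
  move=> S T AS [AT PT]; split.
    by apply: set_mem; apply: AM; apply: mem_set.
  exact: (Alg_stable M S _ _ AS MP PT).
split=> // [IA|J lJ IJ].
  have [_] : I 1 by rewrite IA.
  exact: not_nest_pred.
have [->|/eqP JI] := eqVneq J I; [by left|right].
apply: left_ideal_one => //; have [JA /zmod_setP[J0 JB] AJ] := lJ.
have [B JBB IB] : exists2 B, J B & ~ I B.
  apply: contrapT => nJI; apply: JI; apply/seteqP; split=> // B JBB.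
  by apply: contrapT => IB; apply: nJI; exists B.
have PB : ~ nest_pred M y (B y) by move=> PB; apply: IB; split=> //; apply: JA.
have By0 : B y <> 0 by move=> By0; apply: PB; rewrite By0; left.
have [S AS SB] : exists2 S, Alg M S & S (B y) = y.
  apply: Alg_transitive => // L ML LBy; apply: contrapT => Ly.
  by apply: PB; right; exists L.
have ASB : J (S * B) by apply: AJ.
rewrite -(subrK (S * B) 1) -[X in _ + X]opprK -[X in _ - X]sub0r.
apply: (JB); last by apply: JB.
apply: IJ; split.
  by apply: set_mem; apply: AB; apply: mem_set => //; apply: JA.
by rewrite lin_addE lin_oppE lin_mulE lin_oneE SB subrr; left.
Qed.

Lemma jacobson_sub_triangular M : is_nest M ->
  jacobson_radical (Alg M) `<=` strictly_triangular_ideal M.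
Proof.
move=> nM T [AT radT]; split=> // y.
have [->|/eqP y0] := eqVneq y 0; first by rewrite linear0; left.
by case: (radT _ (maximal_left_ideal_nest_pred M y nM y0)).
Qed.

Lemma triangular_left_ideal M : is_nest M ->
  left_ideal (Alg M) (strictly_triangular_ideal M).
Proof.
move=> nM; have [/set_mem A1 AB AM] := Alg_subring nM; split.
- by move=> T [].
- apply/zmod_setP; split.
    split=> [L ML _ [u _ <-] /=|y]; first by case: (nest_submod M L nM ML).
    by left.
  move=> S T [AS PS] [AT PT]; split=> [|y].
    by apply: set_mem; apply: AB; apply: mem_set.
  have [_ linP] := nest_submod M _ nM (nest_pred_mem M y nM).
  by have := linP (-1) _ _ (PT y) (PS y); rewrite scaleN1r addrC.
- move=> S T AS [AT PT]; split=> [|y].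
    by apply: set_mem; apply: AM; apply: mem_set.
  exact: (Alg_stable M S _ _ AS (nest_pred_mem M y nM) (PT y)).
Qed.
End NestAlgebras.

(** * Annihilators *)

Section Annihilators.
Context {F : fieldType} {X : lmodType F}.
Implicit Types (N : set (set X)) (K L : set X).

Lemma annihilator_submod K : submod_closed [in annihilator K].
Proof.
apply/submod_setP; split=> // a phi psi phi0 psi0 x Kx.
by rewrite lin_addE lin_scaleE phi0 // psi0 // scaler0 addr0.
Qed.

Lemma annihilatorS K L : K `<=` L -> annihilator L `<=` annihilator K.
Proof. by move=> KL phi phi0 x Kx; apply: phi0; apply: KL. Qed.

Lemma annihilator_subset K L : submod_closed [in L] ->
  annihilator L `<=` annihilator K <-> K `<=` L.
Proof.
move=> subL; split=> [LK x Kx|]; last exact: annihilatorS.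
apply: contrapT => Lx.
have [phi phiL phi1] := separating_functional L x subL Lx.
by have /eqP := LK phi phiL x Kx; rewrite phi1 oner_eq0.
Qed.

Lemma annihilator0 : annihilator [set (0 : X)] = setT.
Proof. by apply/seteqP; split=> // phi _ x ->; rewrite linear0. Qed.

Lemma annihilatorT : annihilator (@setT X) = [set 0].
Proof.
apply/seteqP; split=> [phi phi0|_ -> //].
by apply: linear_ext => x; rewrite phi0.
Qed.

Lemma annihilator_bigcup N :
  annihilator (subspace_bigcup N) = \bigcap_(L in N) annihilator L.
Proof.
apply/seteqP; split=> phi phi0 => [L NL x Lx|x [->|[L NL Lx]]].
- by apply: phi0; right; exists L.
- exact: linear0.
- exact: phi0 Lx.
Qed.
End Annihilators.

(** * Annihilators of a nest of type omega *)

Section OmegaNests.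
Context {F : fieldType} {X : lmodType F} {N : set (set X)} {f : nat -> set X}.
Hypothesis nestN : is_nest N.
Hypothesis bijf : set_bij setT (N `\ setT) f.
Hypothesis lef : forall m n, (m <= n)%N <-> f m `<=` f n.

Let memf n : N (f n).
Proof. by case: bijf => + _ _ => /(_ n I) []. Qed.

Let f_neqT n : f n <> setT.
Proof. by case: bijf => + _ _ => /(_ n I) []. Qed.

Let subf n : submod_closed [in f n].
Proof. by case: nestN => + _ _ _ _; apply. Qed.

Let nest_cases L : N L -> L = setT \/ exists n, L = f n.
Proof.
move=> NL; have [->|/eqP LT] := eqVneq L setT; [by left|right].
by case: bijf => _ _ /(_ L (conj NL LT)) [n _ <-]; exists n.
Qed.

Lemma omega_nest_bottom : f 0 = [set 0].
Proof.
have [_ _ [N0 _] _ _] := nestN.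
have f00 n : f n 0 by have /submod_setP[] := subf n.
have [E|[n E]] := nest_cases _ N0.
  case: (f_neqT 0); rewrite -E; apply/seteqP; split=> [x _|_ -> //].
  by rewrite E.
apply/seteqP; split=> [x|_ -> //].
by rewrite E; have /lef := leq0n n; apply.
Qed.

(** The union of the [f n] is a member of [N] above all of them, and the
    sequence has no last term, so this union can only be the whole space. *)
Lemma omega_nest_exhausts x : exists n, f n x.
Proof.
have [_ _ _ _ cupN] := nestN.
have : N (subspace_bigcup (range f)) by apply: cupN => _ [n _ <-].
case/nest_cases => [E|[n E]].
  have : subspace_bigcup (range f) x by rewrite E.
  case=> [->|[_ [n _ <-] fx]]; last by exists n.
  by exists 0%N; rewrite omega_nest_bottom.
have : f n.+1 `<=` f n.
  by rewrite -E => y fy; right; exists (f n.+1) => //; exists n.+1.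
by move/lef; rewrite ltnn.
Qed.

Let annf_le m n : (m <= n)%N <-> annihilator (f n) `<=` annihilator (f m).
Proof. by rewrite lef annihilator_subset. Qed.

Lemma annihilator_nest_is_nest : is_nest (annihilator_nest N).
Proof.
have [_ totN [N0 NT] _ cupN] := nestN; split.
- by move=> _ [K _ <-]; apply: annihilator_submod.
- move=> _ _ [K NK <-] [L NL <-].
  by case: (totN K L NK NL) => KL; [right|left]; apply: annihilatorS.
- split; first by exists setT; rewrite ?annihilatorT.
  by exists [set 0]; rewrite ?annihilator0.
- move=> C CN; pose D := [set L | N L /\ C (annihilator L)].
  exists (subspace_bigcup D); first by apply: cupN => L [].
  rewrite annihilator_bigcup; apply/seteqP; split=> phi phi0 => [L CL|L [_ CL]].
    have [K NK KL] := CN L CL.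
    by rewrite -KL; apply: phi0; split=> //; rewrite KL.
  exact: phi0.
(* The member of least index contains all the others. *)
- move=> C CN.
  have [exC|nexC] := pselect (exists n, `[< C (annihilator (f n)) >]).
    case: (ex_minnP exC) => n /asboolP Cn minn.
    exists (f n) => //; apply/seteqP; split=> [phi phin|phi].
      by right; exists (annihilator (f n)).
    case=> [->|[L CL]].
      by have /submod_setP[] := annihilator_submod (f n).
    have [K NK KL] := CN L CL; rewrite -KL in CL *.
    case: (nest_cases K NK) => [->|[m Km]]; first by apply: annihilatorS.
    rewrite Km in CL *; have /annf_le : (n <= m)%N by apply/minn/asboolP.
    exact.
  exists setT => //; rewrite annihilatorT; apply/seteqP; split=> [_ ->|phi].
    by left.
  case=> [//|[L CL]]; have [K NK KL] := CN L CL; rewrite -KL in CL *.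
  case: (nest_cases K NK) => [->|[m Km]]; first by rewrite annihilatorT.
  by case: nexC; exists m; apply/asboolP; rewrite -Km.
Qed.

Lemma annihilator_nest_anti_omega :
  anti_isomorphic_omega (annihilator_nest N `\ [set 0]).
Proof.
exists (fun n => annihilator (f n)) => //; split.
- move=> n _; split; first by exists (f n).
  rewrite -annihilatorT => E; apply: (f_neqT n).
  by apply/seteqP; split=> //; apply/(annihilator_subset setT) => //; rewrite E.
- move=> m n _ _ E; apply/eqP; rewrite eqn_leq.
  by apply/andP; split; apply/annf_le; rewrite E.
- move=> _ [[K NK <-] K0].
  case: (nest_cases K NK) => [KT|[n ->]]; last by exists n.
  by case: K0; rewrite KT annihilatorT.
Qed.

(** A member of the dual nest that misses some [phi] in [annihilator (f n)] is
    strictly smaller than [annihilator (f n)]. *)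
Lemma triangular_shifts T :
    strictly_triangular_ideal (annihilator_nest N) T ->
  forall n, T @` annihilator (f n) `<=` annihilator (f n.+1).
Proof.
case=> _ predT n _ [phi phin <-].
case: (predT phi) => [->|[_ [[K NK <-] Kphi] KT]].
  by have /submod_setP[] := annihilator_submod (f n.+1).
apply: annihilatorS KT; case: (nest_cases K NK) => [->//|[m Km]].
rewrite Km; apply/lef; rewrite ltnNge; apply/negP => /lef mn.
by apply: Kphi; rewrite Km; apply: annihilatorS phin.
Qed.

(** The left inverse is the Neumann series of [T], evaluated pointwise: on [f m] it
    agrees with its partial sum of order [m]. *)
Lemma triangular_quasi_invertible T :
    strictly_triangular_ideal (annihilator_nest N) T ->
  exists2 R, Alg (annihilator_nest N) R & R * (1 - T) = 1.
Proof.
move=> triT; have shiftT := triangular_shifts T triT.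
have [AT _] := triT.
pose S m : {linear {linear X -> F^o} -> {linear X -> F^o}} :=
  \sum_(k < m) T ^+ k.
have SS m phi x : S m.+1 phi x = S m phi x + (T ^+ m) phi x.
  by rewrite /S big_ord_recr.
have geom m : S m * (1 - T) = 1 - T ^+ m.
  elim: m => [|k IH]; first by rewrite /S big_ord0 mul0r expr0 subrr.
  have -> : S k.+1 = S k + T ^+ k by rewrite /S big_ord_recr.
  by rewrite mulrDl IH mulrBr mulr1 -exprSr addrA subrK.
have powT k phi : annihilator (f k) ((T ^+ k) phi).
  elim: k => [|k IH]; first by rewrite omega_nest_bottom annihilator0.
  by rewrite exprS lin_mulE; apply: shiftT; exists ((T ^+ k) phi).
have stepS m n phi x : f m x -> (m <= n)%N -> S n phi x = S m phi x.
  move=> fx /subnKC <-; elim: (n - m)%N => [|k IH]; first by rewrite addn0.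
  have /lef := leq_addr k m; rewrite addnS SS IH => /(_ x fx) fmkx.
  by rewrite powT ?addr0.
(* [r x] is the order at which the series at [x] is truncated; any [m] with
   [x] in [f m] would give the same value. *)
have [r fr] := choice omega_nest_exhausts.
have rE m phi x : f m x -> S (r x) phi x = S m phi x.
  move=> fx; case: (leqP m (r x)) => [|/ltnW] le; first exact: stepS.
  by symmetry; apply: stepS.
have linR phi : linear ((fun x => S (r x) phi x) : X -> F^o).
  move=> a u v; pose m := maxn (r u) (r v).
  have [fu fv] : f m u /\ f m v.
    by split; [have /lef := leq_maxl (r u) (r v)
             |have /lef := leq_maxr (r u) (r v)];
       apply; apply: fr.
  have /submod_setP[_ lin] := subf m.
  by rewrite (rE m _ (a *: u + v)) ?(rE m _ u) ?(rE m _ v) ?linearP //;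
    apply: lin.
pose R0 phi : {linear X -> F^o} :=
  HB.pack ((fun x => S (r x) phi x) : X -> F^o)
    (GRing.isLinear.Build F X F^o _ _ (linR phi)).
have linR0 : linear R0.
  by move=> a phi psi; apply: linear_ext => x; rewrite /= linearP.
pose R : {linear {linear X -> F^o} -> {linear X -> F^o}} :=
  HB.pack R0 (GRing.isLinear.Build F _ _ _ _ linR0).
exists R; last first.
  apply: linear_ext => phi; apply: linear_ext => x.
  rewrite lin_mulE /=.
  have -> : S (r x) ((1 - T) phi) = (1 - T ^+ r x) phi.
    by rewrite -lin_mulE geom.
  by rewrite !lin_addE !lin_oppE powT // subr0.
move=> _ [K NK <-] _ [phi phiK <-] x Kx /=.
have powK k : annihilator K ((T ^+ k) phi).
  elim: k => // k IH; rewrite exprS lin_mulE.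
  by apply: Alg_stable AT _ IH; exists K.
elim: (r x) => [|k IH]; first by rewrite /S big_ord0.
by rewrite SS IH powK // addr0.
Qed.
End OmegaNests.

Theorem theorem24 (F : fieldType) (X : lmodType F) (N : set (set X))
    (nestN : is_nest N) (omegaN : order_type_omega (N `\ setT)) :
  [/\ is_nest (annihilator_nest N),
      anti_isomorphic_omega (annihilator_nest N `\ [set 0]) &
      strictly_triangular_ideal (annihilator_nest N) =
      jacobson_radical (Alg (annihilator_nest N))].
Proof.
have [f bijf lef] := omegaN.
have nestA := annihilator_nest_is_nest nestN bijf lef; split=> //.
  exact: annihilator_nest_anti_omega nestN bijf lef.
apply/seteqP; split; last exact: jacobson_sub_triangular.
apply: quasiregular_sub_jacobson.
- exact: Alg_subring.
- exact: triangular_left_ideal.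
- exact: triangular_quasi_invertible nestN bijf lef.
Qed.
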